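(* For $n\geq 1$, $$P^{(\mathsf{nest}, \mathsf{cros}, \mathsf{exc}, \mathsf{fix})}(\mathfrak{S}_n; p, q, tq, r)=\left(\frac{1+xt}{1+x}\right)^{n}P^{(\mathsf{nest}, \mathsf{cros},\mathsf{cpk}, \mathsf{exc}, \mathsf{fix})}\left(\mathfrak{S}_n; p, q, \frac{(1+x)^{2}t}{(x+t)(1+xt)},\frac{q(x+t)}{1+xt}, \frac{(1+x)r}{1+xt}\right),$$ equivalently, $$P^{(\mathsf{nest}, \mathsf{cros}, \mathsf{cpk}, \mathsf{exc}, \mathsf{fix})}(\mathfrak{S}_n; p, q, x, qt, r)=\left(\frac{1+u}{1+uv}\right)^{n}P^{(\mathsf{nest}, \mathsf{cros}, \mathsf{exc}, \mathsf{fix})}\left(\mathfrak{S}_n; p, q, qv, \frac{(1+uv)r}{1+u}\right),$$ where $u=\frac{1+t^{2}-2xt-(1-t)\sqrt{(1+t)^{2}-4xt}}{2(1-x)t}$ and $v=\frac{(1+t)^{2}-2xt-(1+t)\sqrt{(1+t)^{2}-4xt}}{2xt}$.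
   Context: $\mathfrak{S}_n$ is the set of permutations of $[n]$. $P^{(\mathsf{stat}_1,\ldots,\mathsf{stat}_m)}(\Omega;t_1,\ldots,t_m)=\sum_{\sigma\in\Omega}\prod_j t_j^{\mathsf{stat}_j\sigma}$. For $\sigma\in\mathfrak{S}_n$: $\mathsf{exc}\,\sigma=\#\{i:\sigma(i)>i\}$, $\mathsf{fix}\,\sigma=\#\{i:\sigma(i)=i\}$, $\mathsf{cpk}\,\sigma=\#\{x\in[n]:\sigma^{-1}(x)<x>\sigma(x)\}$; $\mathsf{nest}_i\sigma=\#\{j: j<i<\sigma(i)<\sigma(j)\text{ or }\sigma(j)<\sigma(i)\le i<j\}$, $\mathsf{cros}_i\sigma=\#\{j: j<i<\sigma(j)<\sigma(i)\text{ or }\sigma(i)<\sigma(j)\le i<j\}$, $\mathsf{nest}=\sum_{i=1}^n\mathsf{nest}_i$, $\mathsf{cros}=\sum_{i=1}^n\mathsf{cros}_i$. *)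

(* Defs.v *)
From HB Require Import structures.
From mathcomp Require Import all_boot all_order all_algebra all_fingroup.
Set Implicit Arguments. Unset Strict Implicit. Unset Printing Implicit Defensive.
Import GRing.Theory.

(* Permutations of [n] are represented as 'S_n = {perm 'I_n}, i.e. on
   {0,...,n-1}; all statistics below only depend on the relative order of
   positions and values, so the shift [n] -> {0..n-1} is harmless. *)

Section Stats.
Variable n : nat.
Implicit Types (s : 'S_n).

Definition exc s : nat := #|[set i : 'I_n | (i < s i)%N]|.
Definition fixs s : nat := #|[set i : 'I_n | s i == i]|.
Definition cpk s : nat :=
  #|[set x : 'I_n | ((s^-1)%g x < x)%N && (s x < x)%N]|.
Definition nest_i s (i : 'I_n) : nat :=
  #|[set j : 'I_n | [&& (j < i)%N, (i < s i)%N & (s i < s j)%N]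
                 || [&& (s j < s i)%N, (s i <= i)%N & (i < j)%N]]|.
Definition cros_i s (i : 'I_n) : nat :=
  #|[set j : 'I_n | [&& (j < i)%N, (i < s j)%N & (s j < s i)%N]
                 || [&& (s i < s j)%N, (s j <= i)%N & (i < j)%N]]|.
Definition nest s : nat := \sum_(i < n) nest_i s i.
Definition cros s : nat := \sum_(i < n) cros_i s i.
End Stats.

Local Open Scope ring_scope.

Definition P_ncef (K : fieldType) (n : nat) (p q y r : K) : K :=
  \sum_(s : 'S_n) p ^+ nest s * q ^+ cros s * y ^+ exc s * r ^+ fixs s.

Definition P_nccef (K : fieldType) (n : nat) (p q z y r : K) : K :=
  \sum_(s : 'S_n) p ^+ nest s * q ^+ cros s * z ^+ cpk s * y ^+ exc s
                  * r ^+ fixs s.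

(* Main.v *)
(* Let G(n,h) be the weighted sum over the permutations of {0..n-1} that map no
   element of {0..h-1} into {0..h-1}, so that G(n,0) is the sum over all of 'S_n. Reading the element h,
   either it is a cyclic valley (the new state is (n,h+1)), or it is a fixed point,
   a cyclic double ascent or descent, or a cyclic peak, and then deleting the rows
   and columns of the permutation matrix closed at h yields, with
   [h] = sum_(j < h) p^j q^(h-1-j),
     G(n+1,h) = G(n+1,h+1) + (r p^h + (q + y) [h]) G(n,h) + z y [h]^2 G(n-1,h-1).
   This is the Motzkin path recurrence of a J-fraction. If c r' = r,
   c (q + y') = q + y and c^2 z' y' = z y, then c^n G'(n,h) satisfies the same
   recurrence as G(n,h); c = (1 + xt)/(1 + x) solves these equations. *)
Require Import Defs.
From mathcomp Require Import all_boot all_order all_algebra all_fingroup.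
From mathcomp Require Import zify ring.
Set Implicit Arguments.
Unset Strict Implicit.
Unset Printing Implicit Defensive.
Import GRing.Theory.
Local Open Scope ring_scope.

(** * Statistics as sums over pairs of matrix entries *)

Section Counting.
Local Open Scope nat_scope.

(* In nestb, crosb and cpkb the arguments u and v stand for the images of i and j. *)
Definition nestb (i u j v : nat) : bool :=
  [&& j < i, i < u & u < v] || [&& v < u, u <= i & i < j].
Definition crosb (i u j v : nat) : bool :=
  [&& j < i, i < v & v < u] || [&& u < v, v <= i & i < j].

Definition cpkb (i u j v : nat) : bool := [&& u == j, i < j & v < j].

Definition pairs (c : nat -> nat -> nat -> nat -> bool) n (s : 'S_n) : nat :=
  \sum_(i < n) \sum_(j < n) c i (s i) j (s j).

Lemma nestE n (s : 'S_n) : nest s = pairs nestb s.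
Proof. by apply: eq_bigr => i _; rewrite /nest_i -sum1dep_card big_mkcond. Qed.

Lemma crosE n (s : 'S_n) : cros s = pairs crosb s.
Proof. by apply: eq_bigr => i _; rewrite /cros_i -sum1dep_card big_mkcond. Qed.

Lemma cpkE n (s : 'S_n) : cpk s = pairs cpkb s.
Proof.
rewrite /pairs exchange_big /cpk -sum1dep_card big_mkcond /=.
apply: eq_bigr => j _; rewrite (bigD1 ((s^-1)%g j)) //= permKV big1 => [|i].
  by rewrite /cpkb eqxx addn0; case: ifP.
by apply: contraNeq; rewrite eqb0 negbK => /and3P[/eqP/val_inj <-]; rewrite permK.
Qed.

Lemma excE n (s : 'S_n) : exc s = \sum_(i < n) (i < s i : nat).
Proof. by rewrite /exc -sum1dep_card big_mkcond. Qed.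

Lemma fixsE n (s : 'S_n) : fixs s = \sum_(i < n) (s i == i : nat).
Proof. by rewrite /fixs -sum1dep_card big_mkcond. Qed.

Lemma sum_ord_lift n (a : 'I_n.+1) (F : 'I_n.+1 -> nat) :
  \sum_i F i = F a + \sum_(i < n) F (lift a i).
Proof.
rewrite (bigD1 a) //=; congr (_ + _).
rewrite (reindex_omap (lift a) (unlift a)) => [|k].
  by apply: eq_bigl => i; rewrite liftK eqxx eq_sym neq_lift.
by rewrite eq_sym; case: unliftP => [k' -> //|->]; rewrite eqxx.
Qed.

Arguments sum_ord_lift {n} a F.

Lemma sum_ord_ltn n m : m <= n -> \sum_(i < n) (i < m : nat) = m.
Proof.
move=> le_mn; rewrite -[RHS](card_ord m) -sum1_card.
by rewrite (big_ord_widen n (fun=> 1)) // [RHS]big_mkcond.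
Qed.

Lemma sum_ord_between n a b : a <= b -> b <= n ->
  \sum_(i < n) (a <= i < b : nat) = b - a.
Proof.
move=> le_ab le_bn.
have: \sum_(i < n) (a <= i < b : nat) + \sum_(i < n) (i < a : nat)
      = \sum_(i < n) (i < b : nat).
  by rewrite -big_split; apply: eq_bigr => i _ /=; lia.
by rewrite !sum_ord_ltn //; lia.
Qed.

(* No entry of the permutation matrix lies in its top left a x b corner. *)
Definition zero_block a b n (s : 'S_n) : bool :=
  [forall i : 'I_n, (i < a) ==> (b <= s i)].

Lemma zero_blockP a b n (s : 'S_n) :
  reflect (forall i : 'I_n, i < a -> b <= s i) (zero_block a b s).
Proof. by exact: 'forall_implyP. Qed.

(** [lift_perm a b s] inserts the entry (a, b) into the permutation matrix; when old pairs keep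
    their status, only pairs with the new entry change the count. *)
Lemma pairs_lift (c : nat -> nat -> nat -> nat -> bool) n (a b : 'I_n.+1) (s : 'S_n) :
  (forall i j : 'I_n, c (lift a i) (lift b (s i)) (lift a j) (lift b (s j))
               = c i (s i) j (s j)) ->
  c a b a b = false ->
  pairs c (lift_perm a b s) =
  pairs c s + \sum_(i < n) (c a b (lift a i) (lift b (s i))
                              + c (lift a i) (lift b (s i)) a b).
Proof.
move=> cE c0; rewrite /pairs (sum_ord_lift a) (sum_ord_lift a).
rewrite !lift_perm_id c0 add0n big_split /= [RHS]addnCA; congr (_ + _).
  by apply: eq_bigr => i _; rewrite lift_perm_lift.
rewrite addnC -big_split; apply: eq_bigr => i _.
rewrite lift_perm_lift (sum_ord_lift a) lift_perm_id; congr (_ + _).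
by apply: eq_bigr => j _; rewrite lift_perm_lift; congr nat_of_bool; exact: cE.
Qed.

(** * Inserting an entry (j, b) above the diagonal *)

Section CloseColumn.
Variables (n : nat) (j b : 'I_n.+1) (s : 'S_n).
Hypotheses (jb : j < b) (Zs : zero_block b.-1 b s).

Let blockP (i : 'I_n) : (b <= i.+1) || (b <= s i).
Proof. by move/zero_blockP/(_ i): Zs; lia. Qed.

(** The other rows above row [b] have their entries to the right of column [b]; those above row [j]
    therefore nest with (j, b). *)
Lemma nest_lift_col : nest (lift_perm j b s) = nest s + j.
Proof.
rewrite !nestE pairs_lift.
- congr (_ + _).
  rewrite -[RHS](@sum_ord_ltn n j); last by have := ltn_ord b; lia.
  apply: eq_bigr => i _; have := blockP i; rewrite /nestb /= /bump; lia.
- move=> i k; have := blockP i; have := blockP k; rewrite /nestb /= /bump; lia.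
- rewrite /nestb; lia.
Qed.

(** The rows strictly between [j] and [b] have images beyond [b], so each crosses the new entry. *)
Lemma cros_lift_col : cros (lift_perm j b s) = cros s + (b.-1 - j).
Proof.
rewrite !crosE pairs_lift.
- congr (_ + _).
  rewrite -[RHS](@sum_ord_between n j b.-1); try by have := ltn_ord b; lia.
  apply: eq_bigr => i _; have := blockP i; rewrite /crosb /= /bump; lia.
- move=> i k; have := blockP i; have := blockP k; rewrite /crosb /= /bump; lia.
- rewrite /crosb; lia.
Qed.

Lemma exc_lift_col : exc (lift_perm j b s) = (exc s).+1.
Proof.
rewrite !excE (sum_ord_lift j) lift_perm_id jb add1n; congr _.+1.
by apply: eq_bigr => i _; rewrite lift_perm_lift /= /bump; have := blockP i; lia.
Qed.

(* When s a <= a, inserting the entry (j, b) makes b a cyclic peak of the lifted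
   permutation; in particular a fixed point a of s is destroyed. *)
Lemma fixs_lift_col (a : 'I_n) : b = a.+1 :> nat ->
  fixs (lift_perm j b s) + (s a == a) = fixs s.
Proof.
move=> ba; rewrite !fixsE (sum_ord_lift j) lift_perm_id -val_eqE /=.
rewrite gtn_eqF // add0n (bigD1 a) //= [RHS](bigD1 a) //=.
rewrite lift_perm_lift -!val_eqE /= addnAC; congr (_ + _).
  by rewrite /bump; lia.
apply: eq_bigr => i; rewrite lift_perm_lift -!val_eqE /= /bump.
by have := blockP i; lia.
Qed.

Lemma cpk_lift_col (a : 'I_n) : b = a.+1 :> nat ->
  cpk (lift_perm j b s) = cpk s + (s a <= a).
Proof.
move=> ba; rewrite !cpkE pairs_lift.
- congr (_ + _); rewrite (bigD1 a) //= big1 => [|i].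
    rewrite /cpkb /bump; lia.
  by rewrite -val_eqE /cpkb /= /bump; have := blockP i; lia.
- move=> i k; have := blockP i; have := blockP k; rewrite /cpkb /= /bump; lia.
- rewrite /cpkb; lia.
Qed.
End CloseColumn.

(** * Inserting an entry (a, v) on or below the diagonal *)

Section CloseRow.
Variables (n : nat) (a v : 'I_n.+1) (s : 'S_n).
Hypotheses (va : v <= a) (Zs : zero_block a a s).

Let blockP (i : 'I_n) : (a <= i) || (a <= s i).
Proof. by move/zero_blockP/(_ i): Zs; lia. Qed.

(** Columns up to [a] other than [v] have their entries below row [a]: those left of [v] nest with
    (a, v), the others cross it. *)
Lemma nest_lift_row : nest (lift_perm a v s) = nest s + v.
Proof.
rewrite !nestE pairs_lift.
- congr (_ + _).
  rewrite -[RHS](@sum_ord_ltn n v); last by have := ltn_ord a; lia.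
  (* The entries counted are indexed by columns, the sum by rows; [s] converts. *)
  rewrite [RHS](reindex_inj (@perm_inj _ s)).
  apply: eq_bigr => i _; have := blockP i; rewrite /nestb /= /bump; lia.
- move=> i k; have := blockP i; have := blockP k; rewrite /nestb /= /bump; lia.
- rewrite /nestb; lia.
Qed.

Lemma cros_lift_row : cros (lift_perm a v s) = cros s + (a - v).
Proof.
rewrite !crosE pairs_lift.
- congr (_ + _).
  rewrite -[RHS](@sum_ord_between n v a) //; last by have := ltn_ord a; lia.
  rewrite [RHS](reindex_inj (@perm_inj _ s)).
  apply: eq_bigr => i _; have := blockP i; rewrite /crosb /= /bump; lia.
- move=> i k; have := blockP i; have := blockP k; rewrite /crosb /= /bump; lia.
- rewrite /crosb; lia.
Qed.

Lemma exc_lift_row : exc (lift_perm a v s) = exc s.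
Proof.
rewrite !excE (sum_ord_lift a) lift_perm_id ltnNge va add0n.
by apply: eq_bigr => i _; rewrite lift_perm_lift /= /bump; have := blockP i; lia.
Qed.

Lemma fixs_lift_row : fixs (lift_perm a v s) = fixs s + (v == a).
Proof.
rewrite !fixsE (sum_ord_lift a) lift_perm_id addnC; congr (_ + _).
apply: eq_bigr => i _; rewrite lift_perm_lift -!val_eqE /= /bump.
by have := blockP i; lia.
Qed.

Lemma cpk_lift_row : cpk (lift_perm a v s) = cpk s.
Proof.
rewrite !cpkE pairs_lift.
- rewrite big1 ?addn0 // => i _; rewrite /cpkb /= /bump.
  by have := blockP i; lia.
- move=> i k; have := blockP i; have := blockP k; rewrite /cpkb /= /bump; lia.
- rewrite /cpkb; lia.
Qed.
End CloseRow.

End Counting.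

(** * Splitting sums by the position of a deleted entry *)

Lemma big_lift_perm (K : nmodType) n (i j : 'I_n.+1) (A : pred 'S_n.+1)
    (F : 'S_n.+1 -> K) :
  \sum_(s | A s && (s i == j)) F s =
  \sum_(s | A (lift_perm i j s)) F (lift_perm i j s).
Proof.
(* [g s] deletes row [i] and its column. Using [s i] rather than [j] makes it injective for every
   [s]; the default [k] is never reached. *)
pose g (s : 'S_n.+1) k := odflt k (unlift (s i) (s (lift i k))).
have gK (s : 'S_n.+1) k : lift (s i) (g s k) = s (lift i k).
  have := neq_lift i k; rewrite /g -(inj_eq (@perm_inj _ s)).
  by case/unlift_some=> ? ? ->.
have g_inj (s : 'S_n.+1) : injective (g s).
  by move=> k l /(congr1 (lift (s i))); rewrite !gK => /perm_inj/lift_inj.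
rewrite (reindex_onto (lift_perm i j) (fun s => perm (g_inj s))) => [|s].
  apply: eq_bigl => s; rewrite lift_perm_id eqxx andbT; apply/andb_idr=> _.
  apply/eqP/permP=> k; apply: (@lift_inj _ j).
  by rewrite permE -{1}(lift_perm_id i j s) gK lift_perm_lift.
case/andP=> _ /eqP si; apply/permP=> k.
case: (unliftP i k) => [l|] ->; last by rewrite lift_perm_id.
by rewrite lift_perm_lift permE -si gK.
Qed.

(** The conditions put the new entry in row [a] or column [b], bordering the corner. *)
Lemma zero_block_lift a b n (i j : 'I_n.+1) (s : 'S_n) :
  (i <= a)%N -> (j <= b)%N -> ((i < a)%N ==> (j == b :> nat)) ->
  zero_block a b (lift_perm i j s) =
  zero_block (a - (i < a))%N (b - (j < b))%N s.
Proof.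
move=> ia jb H; apply/zero_blockP/zero_blockP => Z k.
  move=> ka; have := Z (lift i k); rewrite lift_perm_lift /= /bump; lia.
case: (unliftP i k) => [l|] ->; last by rewrite lift_perm_id; lia.
by have := Z l; rewrite lift_perm_lift /= /bump; lia.
Qed.

(** Either the entry of row [a] avoids the first [b] columns and the corner gains a row, or it lies
    in a column [v < b] and deleting it costs the corner a column. *)
Lemma sum_zero_block_row (K : nmodType) n (a : 'I_n.+1) b (F : 'S_n.+1 -> K) :
  \sum_(s | zero_block a b s) F s =
  \sum_(s | zero_block a.+1 b s) F s +
  \sum_(v : 'I_n.+1 | (v < b)%N)
     \sum_(s | zero_block a b.-1 s) F (lift_perm a v s).
Proof.
rewrite (bigID (fun s : 'S_n.+1 => (s a < b)%N)) /= addrC; congr (_ + _).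
  apply: eq_bigl => s; rewrite -leqNgt.
  apply/andP/zero_blockP => [[/zero_blockP Z ba] k|Z].
    by rewrite ltnS leq_eqVlt => /predU1P[/val_inj->//|/Z].
  by split; [apply/zero_blockP=> k ka|]; apply: Z; lia.
rewrite (partition_big (fun s : 'S_n.+1 => s a) (fun v => (v < b)%N)) /=;
  last by move=> s /andP[].
apply: eq_bigr => v vb.
rewrite (big_lift_perm _ _ (fun s => zero_block a b s && (s a < b)%N)).
apply: eq_bigl => s; rewrite lift_perm_id vb andbT.
rewrite zero_block_lift ?leqnn ?ltnn ?(ltnW vb) //.
by rewrite subn0 vb subn1.
Qed.

Lemma sum_zero_block_col (K : nmodType) n a (b : 'I_n.+1) (F : 'S_n.+1 -> K) :
  \sum_(s | zero_block a b s) F s =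
  \sum_(s | zero_block a b.+1 s) F s +
  \sum_(j : 'I_n.+1 | (j < a)%N)
     \sum_(s | zero_block a.-1 b s) F (lift_perm j b s).
Proof.
rewrite (bigID (fun s : 'S_n.+1 => ((s^-1)%g b < a)%N)) /= addrC; congr (_ + _).
  apply: eq_bigl => s; rewrite -leqNgt.
  apply/andP/zero_blockP => [[/zero_blockP Z ab] k ka|Z].
    rewrite ltn_neqAle Z // andbT; apply: contraTneq ab => /val_inj bE.
    by rewrite bE permK -ltnNge.
  split; first by apply/zero_blockP=> k /Z /ltnW.
  by rewrite leqNgt; apply/negP => /Z; rewrite permKV ltnn.
rewrite (partition_big (fun s : 'S_n.+1 => (s^-1)%g b) (fun j => (j < a)%N)) /=;
  last by move=> s /andP[].
apply: eq_bigr => j ja.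
under eq_bigl => s do rewrite (can2_eq (permKV s) (permK s)) eq_sym.
rewrite (big_lift_perm _ _ (fun s => zero_block a b s && ((s^-1)%g b < a)%N)).
apply: eq_bigl => s; rewrite lift_permV lift_perm_id ja andbT.
rewrite zero_block_lift ?leqnn ?ltnn ?(ltnW ja) ?eqxx ?implybT //.
by rewrite subn0 ja subn1.
Qed.

(** * Weighted sums and their Motzkin recurrence *)

Section Recurrence.
Variables (K : fieldType) (p q z y r : K).

Definition weight n (s : 'S_n) : K :=
  p ^+ nest s * q ^+ cros s * z ^+ cpk s * y ^+ exc s * r ^+ fixs s.

Definition corner_sum n h : K := \sum_(s : 'S_n | zero_block h h s) weight s.

(** This is (p^h - q^h)/(p - q) when p and q differ; at h = 0 the sum is empty. *)
Definition pq_number h : K := \sum_(j < h) p ^+ j * q ^+ (h.-1 - j).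

Lemma weight_lift_row n (a v : 'I_n.+1) (s : 'S_n) :
  (v <= a)%N -> zero_block a a s ->
  weight (lift_perm a v s) = p ^+ v * q ^+ (a - v) * r ^+ (v == a) * weight s.
Proof.
move=> va Zs; rewrite /weight nest_lift_row // cros_lift_row // exc_lift_row //.
by rewrite fixs_lift_row // cpk_lift_row // !exprD; ring.
Qed.

(** Row [a] of [s] becomes row [b]; as [s a >= b], [b] becomes a cyclic double ascent, so no peak
    arises and no fixed point is lost. *)
Lemma weight_lift_col n (j b : 'I_n.+1) (a : 'I_n) (s : 'S_n) :
  b = a.+1 :> nat -> (j < b)%N -> zero_block b b s ->
  weight (lift_perm j b s) = p ^+ j * q ^+ (a - j) * y * weight s.
Proof.
move=> ba jb Zs; have Zs': zero_block b.-1 b s.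
  by apply/zero_blockP=> i ib; apply: (zero_blockP _ _ _ Zs); lia.
have sa : (a < s a)%N by rewrite -ba; apply: (zero_blockP _ _ _ Zs); lia.
have := fixs_lift_col jb Zs' ba; rewrite -val_eqE /= gtn_eqF // addn0 => fE.
rewrite /weight fE nest_lift_col // cros_lift_col // exc_lift_col //.
rewrite (cpk_lift_col jb Zs' ba) leqNgt sa addn0 ba /= !exprD exprS; ring.
Qed.

Lemma weight_lift_peak n (j b : 'I_n.+2) (a v : 'I_n.+1) (s : 'S_n) :
  b = a.+1 :> nat -> (j < b)%N -> (v <= a)%N -> zero_block a a s ->
  weight (lift_perm j b (lift_perm a v s)) =
  p ^+ j * q ^+ (a - j) * y * z * (p ^+ v * q ^+ (a - v)) * weight s.
Proof.
move=> ba jb va Zs; have Zs': zero_block b.-1 b (lift_perm a v s).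
  by rewrite zero_block_lift ?ba //= ?ltnn ?subn0 ?ltnS ?va ?subn1 // ltnW.
have := fixs_lift_col jb Zs' ba.
rewrite lift_perm_id (fixs_lift_row va Zs) => /eqP.
(* If v = a, the outer insertion destroys the fixed point made by the inner one, so no factor [r]
   appears. *)
rewrite eqn_add2r => /eqP fE.
rewrite /weight fE nest_lift_col // cros_lift_col // exc_lift_col //.
rewrite (cpk_lift_col jb Zs' ba) lift_perm_id va ba /=.
rewrite (nest_lift_row va Zs) (cros_lift_row va Zs) (exc_lift_row va Zs).
rewrite (cpk_lift_row va Zs).
by rewrite !exprD expr1 exprS; ring.
Qed.

Lemma corner_sum_rec n h : (h <= n)%N ->
  corner_sum n.+1 h = corner_sum n.+1 h.+1
    + (r * p ^+ h + (q + y) * pq_number h) * corner_sum n h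
    + z * y * pq_number h ^+ 2 * corner_sum n.-1 h.-1.
Proof.
move=> hn; pose b : 'I_n.+1 := Ordinal (hn : (h < n.+1)%N).
(* Column h comes first: an entry in a row j < h makes h a double ascent or a peak. Otherwise row h
   decides between fixed point, double descent and valley. *)
rewrite {1}/corner_sum (sum_zero_block_col h b) (sum_zero_block_row b).
rewrite -/(corner_sum n.+1 h.+1) -!addrA; congr (_ + _).
have rowE : \sum_(v < n.+1 | (v < h.+1)%N) \sum_(s | zero_block b h s)
     weight (lift_perm b v s) = (r * p ^+ h + q * pq_number h) * corner_sum n h.
  transitivity (\sum_(v < n.+1 | (v < h.+1)%N)
      p ^+ v * q ^+ (h - v) * r ^+ (v == h :> nat) * corner_sum n h).
    apply: eq_bigr => v vh; rewrite big_distrr; apply: eq_bigr => s Zs.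
    exact: weight_lift_row.
  rewrite -big_distrl; congr (_ * _).
  rewrite -(big_ord_widen _ (fun v => p ^+ v * q ^+ (h - v) * r ^+ (v == h))) //.
  (* The term v = h is the fixed point; the others carry one more [q] than in [pq_number h]. *)
  rewrite big_ord_recr /= subnn eqxx expr0 mulr1 expr1 addrC mulrC big_distrr.
  congr (_ + _); apply: eq_bigr => v _; rewrite ltn_eqF // expr0 mulr1 /=.
  have -> : (h - v = (h.-1 - v).+1)%N by have := ltn_ord v; lia.
  by rewrite exprS; ring.
rewrite rowE.
suff -> : \sum_(j < n.+1 | (j < h)%N) \sum_(s | zero_block h.-1 b s)
     weight (lift_perm j b s) = pq_number h * (y * corner_sum n h
       + z * y * pq_number h * corner_sum n.-1 h.-1) by ring.
transitivity (\sum_(j < n.+1 | (j < h)%N) p ^+ j * q ^+ (h.-1 - j) *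
  (y * corner_sum n h + z * y * pq_number h * corner_sum n.-1 h.-1)); last first.
  rewrite -big_distrl; congr (_ * _).
  by rewrite -(big_ord_widen _ (fun j => p ^+ j * q ^+ (h.-1 - j))) // ltnW.
apply: eq_bigr => j jh {rowE}; case: h => [//|h] in hn b jh *.
case: n => [//|n] in hn b j jh *; pose a : 'I_n.+1 := Ordinal hn.
(* Row [a] becomes row [b] once (j, b) is inserted: it separates double ascents from peaks. *)
rewrite (sum_zero_block_row a) mulrDr; congr (_ + _).
  rewrite !big_distrr; apply: eq_bigr => s Zs /=.
  by rewrite (@weight_lift_col _ j b a s) // mulrA.
transitivity (\sum_(v < n.+1 | (v < h.+1)%N) p ^+ j * q ^+ (h - j) * y * z *
   (p ^+ v * q ^+ (h - v)) * corner_sum n h).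
  apply: eq_bigr => v vh; rewrite big_distrr; apply: eq_bigr => s Zs.
  exact: weight_lift_peak.
rewrite -big_distrl -big_distrr /=.
rewrite -(big_ord_widen _ (fun v => p ^+ v * q ^+ (h - v))) // /pq_number /=.
by ring.
Qed.

Lemma corner_sum_large n h : (n <= h)%N -> corner_sum n h = (n == 0%N)%:R.
Proof.
case: n => [|n] nh.
  rewrite /corner_sum (big_pred1 1%g) => [|s]; last first.
    by rewrite permS0 /= eqxx; apply/zero_blockP=> -[].
  by rewrite /weight nestE crosE cpkE excE fixsE /pairs !big_ord0 !expr0 !mulr1.
rewrite /corner_sum big_pred0 // => s; apply/negP=> /zero_blockP/(_ ord0).
move=> /(_ (leq_trans (ltn0Sn n) nh)).
by rewrite leqNgt (leq_trans (ltn_ord _) nh).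
Qed.

End Recurrence.

(** * Rescaling the recurrence, and the identity *)

Lemma corner_sum_scale (K : fieldType) (p q z y r z' y' r' c : K) :
  c * r' = r -> c * (q + y') = q + y -> c ^+ 2 * (z' * y') = z * y ->
  forall n h, corner_sum p q z y r n h = c ^+ n * corner_sum p q z' y' r' n h.
Proof.
(* Induction on n - h, which each step of the recurrence lowers by one while h > 0; at h = 0 the
   last term vanishes. *)
move=> rE bE lE n h; have [m] := ubnP (n - h); elim: m n h => // m IH n h.
case: (leqP n h) => [nh _|].
  by rewrite !corner_sum_large //; case: n nh => [|n] nh; rewrite ?mul1r ?mulr0.
case: n => // n; rewrite ltnS => hn nhm.
rewrite (corner_sum_rec p q z) // (corner_sum_rec p q z') //.
rewrite (IH n.+1 h.+1) ?(IH n h); try lia.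
have -> : z * y * pq_number p q h ^+ 2 * corner_sum p q z y r n.-1 h.-1 =
    z * y * pq_number p q h ^+ 2
      * (c ^+ n.-1 * corner_sum p q z' y' r' n.-1 h.-1).
  case: h hn nhm => [|h] hn nhm; first by rewrite /pq_number big_ord0; ring.
  by rewrite (IH n.-1 h) //; lia.
(* Combining c^2 with c^(n-1) needs n > 0; for n = 0 also h = 0, and [0] = 0 removes the term. *)
rewrite -rE -bE -lE; case: n hn {nhm} => [|n] hn; last by rewrite !exprS; ring.
by move: hn; rewrite leqn0 => /eqP ->; rewrite /pq_number big_ord0; ring.
Qed.

Theorem theorem3p10 (K : fieldType) (n : nat) (p q t r x : K) :
  (1 <= n)%N ->
  1 + x != 0 -> x + t != 0 -> 1 + x * t != 0 ->
  P_ncef n p q (t * q) r =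
  ((1 + x * t) / (1 + x)) ^+ n *
  P_nccef n p q ((1 + x) ^+ 2 * t / ((x + t) * (1 + x * t)))
                (q * (x + t) / (1 + x * t))
                ((1 + x) * r / (1 + x * t)).
Proof.
move=> _ x1 xt xt1.
have P_corner z y r' : P_nccef n p q z y r' = corner_sum p q z y r' n 0.
  by apply: eq_bigl => s; apply/esym/zero_blockP.
have -> : P_ncef n p q (t * q) r = corner_sum p q 1 (t * q) r n 0.
  by rewrite -P_corner; apply: eq_bigr => s _; rewrite expr1n mulr1.
(* The equation for [q + y] rests on 1 + xt + x + t = (1 + x)(1 + t). *)
rewrite P_corner; apply: corner_sum_scale; field; rewrite ?x1 ?xt ?xt1 //.
Qed.
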